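(* Let $X:=\{q\in\mathbb H:\max_{i=0,1,2,3}|q_i|\le1\}\cong[-1,1]^4$ and $n:=2^4$. Let $\{X_i\}_{i=1}^n$ be the partition of $X$ into $n$ congruent four-dimensional subcubes of half the side length, and let $l_i:X\to X$, $i=1,\dots,n$, be injections with $l_i(X)=X_i$, so that $l_i(X)\cap l_j(X)=\emptyset$ for $i\neq j$ and $X=\bigcup_{i=1}^n l_i(X)$. Let $q_i,s_i:X\to\mathbb H$, $i=1,\dots,n$, be bounded functions, and let $T:\mathcal B(X,\mathbb H)\to\mathcal B(X,\mathbb H)$ be given by $$Tf(l_i(x)):=q_i(x)+s_i(x)f(x),\qquad x\in X,\ i\in\{1,\dots,n\}.$$ If $$\max_{1\le i\le n}\ \sup_{x\in X}|s_i(x)|<1,$$ then $T$ has a unique fixed point $\psi\in\mathcal B(X,\mathbb H)$, i.e. $$T\psi=\psi\iff\psi(l_i(x))=q_i(x)+s_i(x)\psi(x),\qquad x\in X,\ i\in\{1,\dots,n\}.$$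
   Context: $\mathbb H$ is the real quaternion algebra with basis $e_0=1,e_1,e_2,e_3$; for $q=\sum_{i=0}^3q_ie_i$ the norm is $|q|=\sqrt{q\overline q}=(\sum_{i=0}^3q_i^2)^{1/2}$. The product $s_i(x)f(x)$ is quaternion multiplication, with $s_i(x)$ multiplying from the left. $\mathcal B(X,\mathbb H)$ is the left quaternionic Banach space of bounded functions $f:X\to\mathbb H$ with norm $\|f\|=\sup_{x\in X}|f(x)|$. The $16$ closed subcubes $Q_i$ of side length $1$ obtained by halving each side of $[-1,1]^4$ overlap on their boundaries; the partition $\{X_i\}$ is into pairwise disjoint sets with union $X$ satisfying $\operatorname{int}Q_i\subseteq X_i\subseteq Q_i$. *)

(* Defs.v *)
From HB Require Import structures.
From mathcomp Require Import all_boot all_order all_algebra.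
From mathcomp Require Import ring.
From mathcomp Require Import all_classical all_reals all_analysis.
Set Implicit Arguments.
Unset Strict Implicit.
Unset Printing Implicit Defensive.
Import Order.TTheory GRing.Theory Num.Theory.
Import numFieldNormedType.Exports.
Local Open Scope classical_set_scope.
Local Open Scope ring_scope.

(* The carrier is R^4 with its usual vector space structure and topology.  The
   library's norm on row vectors is the sup norm, so it is deliberately not
   transferred to [quat]; [qnorm] below is the Euclidean norm. *)
Definition quat (R : realType) : Type := 'rV[R]_4.

HB.instance Definition _ (R : realType) :=
  GRing.Lmodule.copy (quat R) 'rV[R]_4.
HB.instance Definition _ (R : realType) :=
  Topological.copy (quat R) 'rV[R]_4.

Definition qcoord (R : realType) (q : quat R) (k : 'I_4) : R :=
  (q : 'rV[R]_4) ord0 k.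

Definition mkquat (R : realType) (a b c d : R) : quat R :=
  \row_(k < 4) [:: a; b; c; d]`_k.

Lemma quatP (R : realType) (p q : quat R) :
  (forall k, qcoord p k = qcoord q k) -> p = q.
Proof. by move=> pq; apply/rowP. Qed.

Lemma mkquatE (R : realType) (a b c d : R) :
  [/\ qcoord (mkquat a b c d) 0 = a, qcoord (mkquat a b c d) 1 = b,
      qcoord (mkquat a b c d) 2 = c & qcoord (mkquat a b c d) 3 = d].
Proof. by split; rewrite /qcoord mxE. Qed.

Lemma quat4P (R : realType) (p q : quat R) :
  [/\ qcoord p 0 = qcoord q 0, qcoord p 1 = qcoord q 1,
      qcoord p 2 = qcoord q 2 & qcoord p 3 = qcoord q 3] -> p = q.
Proof.
move=> [h0 h1 h2 h3]; apply: quatP => -[[|[|[|[|//]]]] hk].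
- by rewrite (_ : Ordinal hk = 0) //; apply: val_inj.
- by rewrite (_ : Ordinal hk = 1) //; apply: val_inj.
- by rewrite (_ : Ordinal hk = 2) //; apply: val_inj.
- by rewrite (_ : Ordinal hk = 3) //; apply: val_inj.
Qed.

Definition qmul (R : realType) (p q : quat R) : quat R :=
  let p0 := qcoord p 0 in let p1 := qcoord p 1 in
  let p2 := qcoord p 2 in let p3 := qcoord p 3 in
  let q0 := qcoord q 0 in let q1 := qcoord q 1 in
  let q2 := qcoord q 2 in let q3 := qcoord q 3 in
  mkquat (p0 * q0 - p1 * q1 - p2 * q2 - p3 * q3)
         (p0 * q1 + p1 * q0 + p2 * q3 - p3 * q2)
         (p0 * q2 - p1 * q3 + p2 * q0 + p3 * q1)
         (p0 * q3 + p1 * q2 - p2 * q1 + p3 * q0).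

Section QuatAlgebra.
Context {R : realType}.
Implicit Types (p q r : quat R) (a : R).

Let qcoordD p q k : qcoord (p + q) k = qcoord p k + qcoord q k.
Proof. by rewrite /qcoord mxE. Qed.

Let qcoordZ a p k : qcoord (a *: p) k = a * qcoord p k.
Proof. by rewrite /qcoord mxE. Qed.

Let mk0 (a b c d : R) : qcoord (mkquat a b c d) 0 = a.
Proof. by case: (mkquatE a b c d). Qed.
Let mk1 (a b c d : R) : qcoord (mkquat a b c d) 1 = b.
Proof. by case: (mkquatE a b c d). Qed.
Let mk2 (a b c d : R) : qcoord (mkquat a b c d) 2 = c.
Proof. by case: (mkquatE a b c d). Qed.
Let mk3 (a b c d : R) : qcoord (mkquat a b c d) 3 = d.
Proof. by case: (mkquatE a b c d). Qed.
Let mkE := (mk0, mk1, mk2, mk3, qcoordD, qcoordZ).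

Lemma qmulA : associative (@qmul R).
Proof. by move=> p q r; apply: quat4P; rewrite /qmul !mkE; split; ring. Qed.

Lemma qmul1l : left_id (mkquat 1 0 0 0) (@qmul R).
Proof. by move=> p; apply: quat4P; rewrite /qmul !mkE; split; ring. Qed.

Lemma qmul1r : right_id (mkquat 1 0 0 0) (@qmul R).
Proof. by move=> p; apply: quat4P; rewrite /qmul !mkE; split; ring. Qed.

Lemma qmulDl : left_distributive (@qmul R) +%R.
Proof. by move=> p q r; apply: quat4P; rewrite /qmul !mkE; split; ring. Qed.

Lemma qmulDr : right_distributive (@qmul R) +%R.
Proof. by move=> p q r; apply: quat4P; rewrite /qmul !mkE; split; ring. Qed.

Lemma quat1_neq0 : mkquat 1 0 0 0 != 0 :> quat R.
Proof.
by apply/eqP => /(congr1 (fun p => qcoord p 0)) /eqP; rewrite mk0 /qcoord mxE oner_eq0.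
Qed.

HB.instance Definition _ := GRing.Zmodule_isNzRing.Build (quat R)
  qmulA qmul1l qmul1r qmulDl qmulDr quat1_neq0.

Lemma qmulE p q : p * q = qmul p q.
Proof. by []. Qed.

Lemma qscaleAl a p q : a *: (p * q) = a *: p * q.
Proof.
by apply: quat4P; rewrite !qmulE /qmul !mkE; split; ring.
Qed.

Lemma qscaleAr a p q : a *: (p * q) = p * (a *: q).
Proof.
by apply: quat4P; rewrite !qmulE /qmul !mkE; split; ring.
Qed.

HB.instance Definition _ := GRing.Lmodule_isLalgebra.Build R (quat R) qscaleAl.
HB.instance Definition _ := GRing.Lalgebra_isAlgebra.Build R (quat R) qscaleAr.

Definition qconj (q : quat R) : quat R :=
  mkquat (qcoord q 0) (- qcoord q 1) (- qcoord q 2) (- qcoord q 3).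

Definition qnorm (q : quat R) : R := Num.sqrt (\sum_(k < 4) qcoord q k ^+ 2).

Let sum4 q : \sum_(k < 4) qcoord q k ^+ 2 =
  qcoord q 0 ^+ 2 + qcoord q 1 ^+ 2 + qcoord q 2 ^+ 2 + qcoord q 3 ^+ 2.
Proof.
rewrite !big_ord_recr big_ord0 /= add0r.
by do ![congr (_ + _)]; congr (qcoord q _ ^+ 2); apply: val_inj.
Qed.

Let sum4_ge0 q : 0 <= \sum_(k < 4) qcoord q k ^+ 2.
Proof. by apply: sumr_ge0 => k _; exact: sqr_ge0. Qed.

Lemma qmul_conj q : q * qconj q = (qnorm q ^+ 2)%:A.
Proof.
rewrite /qnorm sqr_sqrtr ?sum4_ge0// sum4.
by apply: quat4P; rewrite qmulE /GRing.one /= /qmul /qconj !mkE; split; ring.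
Qed.

Lemma qnorm_ge0 q : 0 <= qnorm q.
Proof. exact: sqrtr_ge0. Qed.

Lemma qnormM p q : qnorm (p * q) = qnorm p * qnorm q.
Proof.
rewrite /qnorm -sqrtrM ?sum4_ge0//; congr Num.sqrt; rewrite !sum4.
by rewrite qmulE /qmul !mkE; ring.
Qed.

Lemma ler_qnormD p q : qnorm (p + q) <= qnorm p + qnorm q.
Proof.
have h := qnorm_ge0.
rewrite -(@ler_pXn2r _ 2) ?nnegrE ?addr_ge0//.
rewrite sqrrD /qnorm !sqr_sqrtr ?sum4_ge0//.
pose d := qcoord p 0 * qcoord q 0 + qcoord p 1 * qcoord q 1
  + qcoord p 2 * qcoord q 2 + qcoord p 3 * qcoord q 3.
have -> : \sum_(k < 4) qcoord (p + q) k ^+ 2 =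
    \sum_(k < 4) qcoord p k ^+ 2 + d *+ 2 + \sum_(k < 4) qcoord q k ^+ 2.
  by rewrite !sum4 !mkE /d; ring.
rewrite lerD2r lerD2l lerMn2r /= -sqrtrM ?sum4_ge0//.
apply: le_trans (ler_norm d) _; rewrite -sqrtr_sqr ler_wsqrtr//.
rewrite -subr_ge0 !sum4 /d.
move: (qcoord p 0) (qcoord p 1) (qcoord p 2) (qcoord p 3) => a b c e.
move: (qcoord q 0) (qcoord q 1) (qcoord q 2) (qcoord q 3) => a' b' c' e'.
rewrite [X in 0 <= X](_ : _ = (a * b' - b * a') ^+ 2 + (a * c' - c * a') ^+ 2
  + (a * e' - e * a') ^+ 2 + (b * c' - c * b') ^+ 2 + (b * e' - e * b') ^+ 2
  + (c * e' - e * c') ^+ 2); last by ring.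
by rewrite !addr_ge0 ?sqr_ge0.
Qed.

End QuatAlgebra.

Definition cube (R : realType) : set (quat R) :=
  [set q | \big[Num.max/0]_(k < 4) `|qcoord q k| <= 1].
Arguments cube R : clear implicits.

(* The closed subcube selected by [b]: the [k]-th side is [0, 1] if [b k], and
   [-1, 0] otherwise. *)
Definition subcube (R : realType) (b : {ffun 'I_4 -> bool}) : set (quat R) :=
  [set q | forall k, if b k then 0 <= qcoord q k <= 1
                     else -1 <= qcoord q k <= 0].
Arguments subcube R b : clear implicits.

(* [cube R] used as a type is the subtype of its elements. *)
Record bfun (R : realType) := BFun {
  bfun_val :> cube R -> quat R;
  bfunP : has_ubound [set qnorm (bfun_val x) | x in [set: cube R]] }.

Definition bnorm (R : realType) (f : bfun R) : R :=
  sup [set qnorm (f x) | x in [set: cube R]].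

Lemma bfun_eqP (R : realType) (f g : bfun R) : f =1 g -> f = g.
Proof.
case: f g => [f hf] [g hg] /= /funext fg; subst g.
by congr BFun; exact: Prop_irrelevance.
Qed.

Lemma qnorm_le_bnorm (R : realType) (f : bfun R) x : qnorm (f x) <= bnorm f.
Proof. by apply: (ub_le_sup (bfunP f)); exists x. Qed.

Lemma bnorm_ge0 (R : realType) (f : bfun R) : 0 <= bnorm f.
Proof.
have c0 : cube R 0.
  by rewrite /cube /=; apply: bigmax_le => // k _; rewrite /qcoord mxE normr0.
exact: le_trans (qnorm_ge0 _) (qnorm_le_bnorm f (exist _ 0 (mem_set c0))).
Qed.

(* Exactly one self-map [T] of [bfun R] satisfies the functional equation below,
   so taking such a [T] as a hypothesis is not vacuous. *)
Lemma RB_operator_exists (R : realType) (I : finType)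
    (l : I -> cube R -> cube R) (q s : I -> bfun R) :
  (forall i, injective (l i)) ->
  trivIset [set: I] (fun i => range (l i)) ->
  \bigcup_i range (l i) = [set: cube R] ->
  exists! T : bfun R -> bfun R, forall (f : bfun R) (i : I) (x : cube R),
    T f (l i x) = q i x + s i x * f x.
Proof.
move=> linj ltriv lcov.
have lsurj y : exists ix : I * cube R, l ix.1 ix.2 = y.
  have : [set: cube R] y by [].
  by rewrite -lcov => -[i _ [x _ <-]]; exists (i, x).
have [inv invK] := choice lsurj.
have invE i x : inv (l i x) = (i, x).
  have := invK (l i x); case: (inv (l i x)) => j y /= e.
  have ij : j = i.
    by apply: ltriv => //; exists (l i x); split; [exists y | exists x].
  by rewrite ij in e *; rewrite (linj _ _ _ e).
pose g (f : bfun R) y := q (inv y).1 (inv y).2 + s (inv y).1 (inv y).2 * f (inv y).2.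
have gP f : has_ubound [set qnorm (g f x) | x in [set: cube R]].
  exists (\sum_i (bnorm (q i) + bnorm (s i) * bnorm f)) => _ [y _ <-].
  rewrite /g; case: (inv y) => i x /=; rewrite (bigD1 i)//=.
  apply: le_trans (ler_qnormD _ _) _; rewrite qnormM -[leLHS]addr0 lerD//.
    by rewrite lerD ?ler_pM ?qnorm_le_bnorm ?qnorm_ge0.
  by apply: sumr_ge0 => j _; rewrite addr_ge0 ?mulr_ge0 ?bnorm_ge0.
exists (fun f => BFun (gP f)); split=> [f i x|T TE]; first by rewrite /= /g invE.
apply/funext => f; apply: bfun_eqP => y /=.
by rewrite /g -[in RHS](invK y) TE.
Qed.

(* Main.v *)
Require Import Defs.
From mathcomp Require Import all_boot all_order all_algebra.
From mathcomp Require Import lra ring.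
From mathcomp Require Import all_classical all_reals all_analysis.
Import Order.TTheory GRing.Theory Num.Theory.
Import numFieldNormedType.Exports.
Local Open Scope classical_set_scope.
Local Open Scope ring_scope.

(** The theorem is the Banach fixed point theorem in the space of bounded
    quaternion-valued functions.  Put [c := max_i bnorm (s i) < 1].  Since the
    sets [X_ i] cover the cube, every point has the form [l i x], and there
    [T f - T g] equals [s i x * (f x - g x)]; the quaternion norm being
    multiplicative, a uniform bound [M] on [f - g] becomes the bound [c * M] on
    [T f - T g].  The iterates of [T] therefore move by at most [D * c ^+ n] at
    step [n], at every point of the cube, and
    [geometric_steps_approx_quat], the completeness of the quaternions,
    gives a pointwise limit together with an error bound independent of the
    point.  Uniformity makes the limit bounded, and it makes the limit a fixed
    point because [T] contracts uniform errors ([contraction_fixpoint]).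
    Surjectivity of the family [l] also gives the equivalence of [T psi = psi]
    with the functional equation. *)

Lemma qnormN {R : realType} (p : quat R) : qnorm (- p) = qnorm p.
Proof.
by congr Num.sqrt; apply: eq_bigr => k _; rewrite /qcoord mxE sqrrN.
Qed.

Lemma ler_qnormB {R : realType} (p r : quat R) :
  qnorm (p - r) <= qnorm p + qnorm r.
Proof. by rewrite -(qnormN r) ler_qnormD. Qed.

Lemma qnorm0_eq0 {R : realType} (p : quat R) : qnorm p = 0 -> p = 0.
Proof.
move=> /eqP; rewrite sqrtr_eq0 => p_le0.
have p_eq0 : \sum_(k < 4) qcoord p k ^+ 2 == 0.
  by rewrite eq_le p_le0 sumr_ge0 // => k _; exact: sqr_ge0.
apply: quatP => k; move: p_eq0.
rewrite psumr_eq0 => [|j _]; last exact: sqr_ge0.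
move=> /allP/(_ k (mem_index_enum _)) /=.
by rewrite sqrf_eq0 => /eqP ->; rewrite /qcoord mxE.
Qed.

Lemma ler_qcoord_qnorm {R : realType} (p : quat R) k : `|qcoord p k| <= qnorm p.
Proof.
rewrite -sqrtr_sqr ler_wsqrtr // (bigD1 k) //= lerDl.
by apply: sumr_ge0 => j _; exact: sqr_ge0.
Qed.

Lemma qnorm_le_qcoord {R : realType} (p : quat R) (M : R) :
  (forall k, `|qcoord p k| <= M) -> qnorm p <= 2 * M.
Proof.
move=> pM; have M0 : 0 <= M := le_trans (normr_ge0 _) (pM 0).
rewrite -(@ger0_norm _ (2 * M)) ?mulr_ge0 // -sqrtr_sqr ler_wsqrtr //.
rewrite (_ : (2 * M) ^+ 2 = \sum_(k < 4) M ^+ 2).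
  apply: ler_sum => k _.
  by rewrite -real_normK ?num_real // lerXn2r ?nnegrE.
by rewrite sumr_const card_ord; ring.
Qed.

Lemma le_geometric_le0 {R : realType} {c M x : R} :
  0 <= c < 1 -> (forall n, x <= M * c ^+ n) -> x <= 0.
Proof.
move=> /andP[c0 c1] xM.
have cvM : (fun n => M * c ^+ n) @ \oo --> M * 0.
  by apply: cvgMr; apply: cvg_expr; rewrite ger0_norm.
rewrite -(mulr0 M) -(cvg_lim _ cvM) //.
by apply: limr_ge; [apply/cvg_ex; exists (M * 0) | exact: nearW].
Qed.

(** With [K := D / (1 - c)] the intervals [[a n - K * c ^+ n, a n + K * c ^+ n]]
    are nested, as [K * c ^+ n - K * c ^+ n.+1 = D * c ^+ n] is exactly the
    permitted step; a point common to all of them is the limit, with the error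
    estimate built in. *)
Lemma geometric_steps_approx {R : realType} {c D : R} (a : nat -> R) :
  0 <= c < 1 -> (forall n, `|a n.+1 - a n| <= D * c ^+ n) ->
  exists L, forall n, `|L - a n| <= D / (1 - c) * c ^+ n.
Proof.
move=> /andP[c0 c1] aD; set K := D / (1 - c).
have c1N0 : 1 - c != 0 by rewrite subr_eq0 gt_eqF.
have KE n : K * c ^+ n.+1 = K * c ^+ n - D * c ^+ n.
  by rewrite exprS /K; field.
pose lo n := a n - K * c ^+ n; pose hi n := a n + K * c ^+ n.
have D0 : 0 <= D by have := le_trans (normr_ge0 _) (aD 0%N); rewrite expr0 mulr1.
have K0 n : 0 <= K * c ^+ n.
  by rewrite mulr_ge0 ?exprn_ge0 // divr_ge0 // subr_ge0 ltW.
have lo_nd : {homo lo : m n / (m <= n)%N >-> m <= n}.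
  apply: homo_leq => [//|x y z|n]; first exact: le_trans.
  by have := aD n; rewrite ler_norml /lo KE => /andP[]; lra.
have hi_ni : {homo hi : m n / (m <= n)%N >-> n <= m}.
  apply: homo_leq => [//|x y z yx zy|n]; first exact: le_trans zy yx.
  by have := aD n; rewrite ler_norml /hi KE => /andP[]; lra.
have lo_hi m n : lo m <= hi n.
  have lohi p : lo p <= hi p by have := K0 p; rewrite /lo /hi; lra.
  apply: le_trans (lo_nd _ _ (leq_maxl m n)) _.
  exact: le_trans (lohi _) (hi_ni _ _ (leq_maxr m n)).
exists (sup (range lo)) => n.
have Llo : lo n <= sup (range lo).
  by apply: ub_le_sup; [exists (hi n) => _ [m _ <-] | exists n].
have Lhi : sup (range lo) <= hi n.
  by apply: ge_sup; [exists (lo 0%N), 0%N | move=> _ [m _ <-]].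
by rewrite ler_norml; move: Llo Lhi; rewrite /lo /hi; lra.
Qed.

(** The quaternion version is coordinatewise; the factor 2 compares the maximum
    of the four coordinates with the Euclidean norm. *)
Lemma geometric_steps_approx_quat {R : realType} {c D : R} (u : nat -> quat R) :
  0 <= c < 1 -> (forall n, qnorm (u n.+1 - u n) <= D * c ^+ n) ->
  exists v, forall n, qnorm (v - u n) <= 2 * (D / (1 - c)) * c ^+ n.
Proof.
move=> c01 uD.
have qcoordB p r k : qcoord (p - r : quat R) k = qcoord p k - qcoord r k.
  by rewrite /qcoord !mxE.
have coordD k n : `|qcoord (u n.+1) k - qcoord (u n) k| <= D * c ^+ n.
  by rewrite -qcoordB; exact: le_trans (ler_qcoord_qnorm _ _) (uD n).
have [L LP] := choice (fun k => geometric_steps_approx _ c01 (coordD k)).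
exists (\row_k L k : 'rV[R]_4) => n; rewrite -mulrA.
by apply: qnorm_le_qcoord => k; rewrite qcoordB [X in X - _]mxE.
Qed.

(** The contraction property is expressed through uniform bounds [M] on
    [f - g], which amounts to a Lipschitz condition for the supremum norm and
    spares a vector space structure on [bfun R]. *)
Lemma contraction_fixpoint {R : realType} {c : R} (T : bfun R -> bfun R) :
  0 <= c < 1 ->
  (forall (f g : bfun R) M, (forall x, qnorm (f x - g x) <= M) ->
     forall x, qnorm (T f x - T g x) <= c * M) ->
  exists! psi : bfun R, T psi = psi.
Proof.
move=> c01 T_contr.
have eq_geometric (f g : bfun R) M :
    (forall n x, qnorm (f x - g x) <= M * c ^+ n) -> f = g.
  move=> fgM; apply: bfun_eqP => x; apply/eqP; rewrite -subr_eq0; apply/eqP.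
  apply: qnorm0_eq0; apply/le_anti; rewrite qnorm_ge0 andbT.
  exact: le_geometric_le0 c01 (fgM ^~ x).
have bnorm_dist (f g : bfun R) x : qnorm (f x - g x) <= bnorm f + bnorm g.
  exact: le_trans (ler_qnormB _ _) (lerD (qnorm_le_bnorm _ _) (qnorm_le_bnorm _ _)).
have f0P : has_ubound [set qnorm ((fun=> 0) x : quat R) | x in [set: cube R]].
  by exists (qnorm 0) => _ [x _ <-].
pose u n := iter n T (BFun f0P).
pose D := bnorm (u 1%N) + bnorm (u 0%N).
have uD n x : qnorm (u n.+1 x - u n x) <= D * c ^+ n.
  elim: n x => [|n IHn] x; first by rewrite expr0 mulr1 bnorm_dist.
  by rewrite exprS mulrCA; exact: T_contr IHn x.
have [psi0 psi0P] :=
  choice (fun x => geometric_steps_approx_quat _ c01 (uD ^~ x)).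
set K := 2 * (D / (1 - c)) in psi0P.
have psiP : has_ubound [set qnorm (psi0 x) | x in [set: cube R]].
  exists (K + bnorm (u 0%N)) => _ [x _ <-]; rewrite -(subrK (u 0%N x) (psi0 x)).
  apply: le_trans (ler_qnormD _ _) (lerD _ (qnorm_le_bnorm _ _)).
  by have := psi0P x 0%N; rewrite expr0 mulr1.
set psi := BFun psiP.
have Tpsi : T psi = psi.
  (* compare both sides with the iterate [u n.+1 = T (u n)] *)
  apply: (eq_geometric _ _ (c * K + K * c)) => n x.
  rewrite mulrDl -(mulrA c) -(mulrA K) -exprS.
  rewrite -(subrK (u n.+1 x) (T _ x)) -addrA.
  apply: le_trans (ler_qnormD _ _) (lerD _ _).
    by apply: T_contr => y; exact: psi0P.
  by rewrite -qnormN opprB; exact: psi0P.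
exists psi; split=> // phi Tphi.
apply: (eq_geometric _ _ (bnorm psi + bnorm phi)).
elim=> [|n IHn] x; first by rewrite expr0 mulr1 bnorm_dist.
by rewrite -[in leLHS]Tpsi -[in leLHS]Tphi exprS mulrCA; exact: T_contr IHn x.
Qed.

Theorem theorem5p1 (R : realType)
  (b : 'I_(2 ^ 4) -> {ffun 'I_4 -> bool}) (b_bij : bijective b)
  (X_ : 'I_(2 ^ 4) -> set (quat R))
  (X_partition : partition [set: 'I_(2 ^ 4)] X_ (cube R))
  (X_subcube : forall i, interior (subcube R (b i)) `<=` X_ i
                         /\ X_ i `<=` subcube R (b i))
  (l : 'I_(2 ^ 4) -> cube R -> cube R)
  (l_inj : forall i, injective (l i))
  (l_image : forall i, [set \val (l i x) | x in [set: cube R]] = X_ i)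
  (q s : 'I_(2 ^ 4) -> bfun R)
  (T : bfun R -> bfun R)
  (T_def : forall (f : bfun R) (i : 'I_(2 ^ 4)) (x : cube R),
      T f (l i x) = q i x + s i x * f x)
  (s_lt1 : \big[Num.max/0]_(i < 2 ^ 4) bnorm (s i) < 1) :
  (exists! psi : bfun R, T psi = psi) /\
  (forall psi : bfun R,
      T psi = psi <->
      (forall (i : 'I_(2 ^ 4)) (x : cube R),
          psi (l i x) = q i x + s i x * psi x)).
Proof.
have l_surj y : exists i x, l i x = y.
  have [X_cover _ _] := X_partition.
  have : cover [set: _] X_ (\val y) by rewrite X_cover; exact: set_mem (valP y).
  by move=> [i _]; rewrite -l_image => -[x _ /val_inj <-]; exists i, x.
split.
  apply: (@contraction_fixpoint _ (\big[Num.max/0]_(i < 2 ^ 4) bnorm (s i))).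
    by rewrite s_lt1 bigmax_ge_id.
  move=> f g M fgM y; have [i [x <-]] := l_surj y.
  rewrite !T_def opprD addrACA subrr add0r -mulrBr qnormM.
  apply: ler_pM; rewrite ?qnorm_ge0 //.
  exact: le_trans (qnorm_le_bnorm _ _) (le_bigmax _ _ i).
move=> psi; split=> [Tpsi i x|psiE]; first by rewrite -T_def Tpsi.
by apply: bfun_eqP => y; have [i [x <-]] := l_surj y; rewrite T_def psiE.
Qed.
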